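(* Let $\mathcal O$ be one of the rings $\mathbb Z[\sqrt D]$ with $D\in\{-1,-2\}$, or $\mathbb Z[\tfrac12(1+\sqrt D)]$ with $D\in\{-3,-7,-11\}$. Let $\{\boldsymbol\alpha,\boldsymbol\beta\}$ be a basis of $\mathbb C^2$ with $|\det[\boldsymbol\alpha\ \boldsymbol\beta]|=1$, and let $\mathcal L=\{n_1\boldsymbol\alpha+n_2\boldsymbol\beta: n_1,n_2\in\mathcal O\}$. Suppose the basis is greedy reduced, i.e. $$\|\boldsymbol\alpha\|\le\|\boldsymbol\beta\|\quad\text{and}\quad\|\boldsymbol\beta+n\boldsymbol\alpha\|\ge\|\boldsymbol\beta\|\ \text{ for all } n\in\mathcal O .$$ Then $\{\boldsymbol\alpha,\boldsymbol\beta\}$ is a shortest reduced basis of $\mathcal L$: $\boldsymbol\alpha$ is a shortest nonzero vector of $\mathcal L$, and $\boldsymbol\beta$ is a shortest vector among the vectors of $\mathcal L$ that are linearly independent (over $\mathbb C$) from $\boldsymbol\alpha$.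
   Context: $\|\cdot\|$ is the standard Hermitian norm on $\mathbb C^2$. *)

(* Defs.v *)
From HB Require Import structures.
From mathcomp Require Import all_boot all_order all_algebra.
From mathcomp Require Import complex reals.

Set Implicit Arguments.
Unset Strict Implicit.
Unset Printing Implicit Defensive.

Import Order.TTheory GRing.Theory Num.Theory.
Local Open Scope ring_scope.

(* [dotmx] is defined on row vectors, hence the transposes.  The norm is
   C-valued but real and nonnegative, so the partial order of C compares
   norms as real numbers. *)
Definition hnorm (C : numClosedFieldType) (u : 'cV[C]_2) : C :=
  sqrtC (dotmx u^T u^T).

(* Z[w] as a predicate on z. *)
Definition Zadjoin (C : numClosedFieldType) (w z : C) : Prop :=
  exists p : {poly int}, z = (map_poly intr p).[w].

(* [sqrtC] of a negative real is the root with positive imaginary part. *)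
Definition listed_ring (C : numClosedFieldType) (O : C -> Prop) : Prop :=
  (exists2 D : int, D \in [:: -1; -2] & O = Zadjoin (sqrtC D%:~R)) \/
  (exists2 D : int, D \in [:: -3; -7; -11] &
     O = Zadjoin (2%:R^-1 * (1 + sqrtC D%:~R))).

Definition lattice (C : numClosedFieldType) (O : C -> Prop)
    (a b v : 'cV[C]_2) : Prop :=
  exists n1 n2 : C, [/\ O n1, O n2 & v = n1 *: a + n2 *: b].

Definition greedy_reduced (C : numClosedFieldType) (O : C -> Prop)
    (a b : 'cV[C]_2) : Prop :=
  hnorm a <= hnorm b /\
  (forall n : C, O n -> hnorm (b + n *: a) >= hnorm b).

Definition basis_of_lattice (C : numClosedFieldType) (O : C -> Prop)
    (L : 'cV[C]_2 -> Prop) (a b : 'cV[C]_2) : Prop :=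
  free [:: a; b] /\ (forall v, L v <-> lattice O a b v).

Definition shortest_reduced (C : numClosedFieldType) (O : C -> Prop)
    (L : 'cV[C]_2 -> Prop) (a b : 'cV[C]_2) : Prop :=
  [/\ basis_of_lattice O L a b,
      [/\ L a, a != 0 & forall v, L v -> v != 0 -> hnorm a <= hnorm v] &
      [/\ L b, free [:: a; b] &
          forall v, L v -> free [:: a; v] -> hnorm b <= hnorm v]].

(* Main.v *)
Require Import Defs.
From HB Require Import structures.
From mathcomp Require Import all_boot all_order all_algebra.
From mathcomp Require Import complex reals ring lra zify.

Set Implicit Arguments.
Unset Strict Implicit.
Unset Printing Implicit Defensive.

Import Order.TTheory GRing.Theory Num.Theory.
Local Open Scope ring_scope.

(** Write O = Z + Zw with w + w^* = t and w w^* = N; the five rings are the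
    five pairs (t, N) in [euclidean_pairs].  With A = ||alpha||^2,
    B = ||beta||^2, c = <alpha, beta> and Tr z = z + z^*,

      ||n1 alpha + n2 beta||^2 = |n1|^2 A + |n2|^2 B + Tr (n1 n2^* c).

    Everything rests on the claim that this is at least B when n2 != 0
    ([greedy_lattice_le]): such vectors are no shorter than beta, hence no
    shorter than alpha, while a nonzero n1 alpha is no shorter than alpha
    because nonzero elements of O have integral norm, hence norm at least 1.

    Suppose first A = B = 1.  Greediness says that c lies in the Voronoi cell
    of O around 0, and for fixed n1, n2 the right-hand side is affine in the
    real coordinates (Tr c, Tr (w c)) of c.  It is therefore enough to bound it
    when c is a vertex z of the cell ([exists_dual_vertex]).  Two facts about
    these vertices, which can be read off for each ring, finish the argument.
    They lie in the inverse different of O, so that Tr (n1 n2^* z) is an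
    integer; and, O being Euclidean, |z| < 1, so that
      |n1|^2 + |n2|^2 + Tr (n1 n2^* z)
        = |n1 + n2 z^*|^2 + (1 - |z|^2) |n2|^2 > 0.
    A positive integer is at least 1 ([dual_form_ge1]).

    For general A <= B, rescaling c by A gives the bound A for the value of the
    form with B replaced by A, and |n2|^2 >= 1 shows that replacing A by B in
    the second coefficient adds at least B - A ([reduced_form_ge]). *)

(** * Integral forms *)

(** The norm of x + y w. *)
Definition qnorm (t N x y : int) : int := x ^+ 2 + t * x * y + N * y ^+ 2.

Lemma qnorm_ge1 (t N x y : int) :
  t ^+ 2 < 4 * N -> (x != 0) || (y != 0) -> 1 <= qnorm t N x y.
Proof.
move=> disc nz.
suff: 0 < 4 * qnorm t N x y by lia.
have -> : 4 * qnorm t N x y = (2 * x + t * y) ^+ 2 + (4 * N - t ^+ 2) * y ^+ 2.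
  by rewrite /qnorm; ring.
have [y0|y0] := eqVneq y 0; last first.
  by rewrite ltr_wpDl ?sqr_ge0 // mulr_gt0 ?subr_gt0 // exprn_even_gt0.
move: nz; rewrite y0 eqxx orbF => x0.
by rewrite !(mulr0, expr0n, addr0) /= exprn_even_gt0 // mulf_neq0.
Qed.

(** The value of |n1|^2 + |n2|^2 + Tr (n1 n2^* z) for n1 = x1 + y1 w and
    n2 = x2 + y2 w, where z is the element of the inverse different with
    Tr z = z1 and Tr (w z) = z2; the factors of z1 and z2 are the coordinates
    of n1 n2^* in the basis (1, w). *)
Definition dual_form (t N z1 z2 x1 y1 x2 y2 : int) : int :=
  qnorm t N x1 y1 + qnorm t N x2 y2
  + (x1 * x2 + t * x1 * y2 + N * y1 * y2) * z1 + (y1 * x2 - x1 * y2) * z2.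

(** The bound on z1, z2 means |z| < 1, since
    |z|^2 = qnorm (- t) N z2 z1 / (4 N - t^2).  It makes the form positive, and
    the form is integral. *)
Lemma dual_form_ge1 (t N z1 z2 x1 y1 x2 y2 : int) :
  t ^+ 2 < 4 * N -> qnorm (- t) N z2 z1 < 4 * N - t ^+ 2 ->
  (x2 != 0) || (y2 != 0) -> 1 <= dual_form t N z1 z2 x1 y1 x2 y2.
Proof.
move=> disc inside nz; pose D := 4 * N - t ^+ 2.
have D_gt0 : 0 < D by rewrite subr_gt0.
suff: 0 < D * dual_form t N z1 z2 x1 y1 x2 y2 by rewrite pmulr_rgt0.
(* With d = 2 w - t, so that d d^* = D, the element d z^* is - z2 + z1 w, and
   u + v w = d n1 + d z^* n2.  The identity below is D times the completion of
   the square |n1 + n2 z^*|^2 + (1 - |z|^2) |n2|^2. *)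
pose u := - t * x1 - 2 * N * y1 - x2 * z2 - N * y2 * z1.
pose v := 2 * x1 + t * y1 + x2 * z1 - y2 * z2 + t * y2 * z1.
have -> : D * dual_form t N z1 z2 x1 y1 x2 y2 =
    qnorm t N u v + (D - qnorm (- t) N z2 z1) * qnorm t N x2 y2.
  by rewrite /D /dual_form /u /v /qnorm; ring.
have uv_ge0 : 0 <= qnorm t N u v.
  have [/(qnorm_ge1 disc)/(le_trans ler01) //|] := boolP ((u != 0) || (v != 0)).
  by rewrite negb_or !negbK => /andP[/eqP-> /eqP->]; rewrite /qnorm; lia.
rewrite ltr_wpDl // mulr_gt0 ?subr_gt0 //.
by apply: lt_le_trans (qnorm_ge1 disc nz).
Qed.

(** * Vertices of the Voronoi cell *)

Definition euclidean_pairs : seq (int * int) :=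
  [:: (0, 1); (0, 2); (1, 1); (1, 2); (1, 3)].

Lemma euclidean_pairs_disc (t N : int) :
  (t, N) \in euclidean_pairs -> t ^+ 2 < 4 * N.
Proof. by rewrite !inE => /or4P[||| /orP[]] /eqP[-> ->]. Qed.

(** Minimising a linear form over a polygon: its minimum is attained at a
    vertex.  The hypothesis with (m, k) equal to one of +-(1, 0), +-(0, 1) and,
    if t = 1, +-(1, -1) says |P| <= A, |Q| <= N A and, if t = 1,
    |P - Q| <= N A: a rectangle with vertices A (+-1, +-N) if t = 0, and a
    hexagon with vertices +-A (1, N), +-A (0, N), +-A (1, 1 - N) if t = 1.
    The vertex depends on which two constraints generate the cone of normals
    that contains (x, y). *)
Lemma exists_dual_vertex (R : realFieldType) (t N x y : int) (A P Q : R) :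
  (t, N) \in euclidean_pairs ->
  (forall m k : int, 0 <= (qnorm t N m k)%:~R * A + m%:~R * P + k%:~R * Q) ->
  exists z1 z2 : int, qnorm (- t) N z2 z1 < 4 * N - t ^+ 2 /\
    (x * z1 + y * z2)%:~R * A <= x%:~R * P + y%:~R * Q.
Proof.
(* The cell is symmetric under c |-> - c. *)
move=> tN; wlog y_ge0 : x y P Q / 0 <= y => [wlog_y_ge0 reduced|].
  have [y_ge0|/ltW y_le0] := leP 0 y; first exact: wlog_y_ge0.
  have [||z1 [z2 [inside le_z]]] := wlog_y_ge0 (- x) (- y) (- P) (- Q).
  - by rewrite oppr_ge0.
  - move=> m k; have := reduced (- m) (- k).
    by rewrite /qnorm !(mulrN, mulNr, sqrrN, rmorphN, opprK).
  exists (- z1), (- z2); move: inside le_z.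
  by rewrite /qnorm !(mulrN, mulNr, sqrrN, rmorphN, opprK).
move=> reduced.
have P_ge := reduced 1 0; have P_le := reduced (-1) 0; have Q_ge := reduced 0 1.
have QP_ge := reduced (-1) 1.
have scale (a : int) (u : R) : 0 <= a -> 0 <= u -> 0 <= a%:~R * u.
  by move=> a_ge0; apply: mulr_ge0; rewrite ler0z.
rewrite -(ler0z R) in y_ge0.
have [x_ge0 | /ltW x_le0] := leP 0 x.
- exists (-1), (- N); split.
    by move: tN; rewrite !inE => /or4P[||| /orP[]] /eqP[-> ->].
  have := scale _ _ x_ge0 P_ge; have := mulr_ge0 y_ge0 Q_ge.
  rewrite /qnorm; lra.
have nx_ge0 : 0 <= - x%:~R :> R by rewrite oppr_ge0 lerz0.
have [t0|t1] : t = 0 \/ t = 1.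
  by move: tN; rewrite !inE => /or4P[||| /orP[]] /eqP[-> _];
    [left|left|right|right|right].
- exists 1, (- N); split.
    by move: tN; rewrite t0 !inE => /or4P[||| /orP[]] /eqP[] // ->.
  have := mulr_ge0 nx_ge0 P_le; have := mulr_ge0 y_ge0 Q_ge.
  rewrite /qnorm; lra.
have [xy_ge0 | /ltW xy_le0] := leP 0 (x + y).
- exists 0, (- N); split.
    by move: tN; rewrite t1 !inE => /or4P[||| /orP[]] /eqP[] // ->.
  have := mulr_ge0 nx_ge0 QP_ge; have := scale _ _ xy_ge0 Q_ge.
  rewrite t1 /qnorm; lra.
- exists 1, (1 - N); split.
    by move: tN; rewrite t1 !inE => /or4P[||| /orP[]] /eqP[] // ->.
  rewrite -oppr_ge0 in xy_le0.
  have := mulr_ge0 y_ge0 QP_ge; have := scale _ _ xy_le0 P_le.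
  rewrite t1 /qnorm; lra.
Qed.

(** The value of the form is the sum of its value at B = A, which is at least A
    by passing to a vertex, and of |n2|^2 (B - A) >= B - A. *)
Lemma reduced_form_ge (R : realFieldType) (t N : int) (A B P Q : R) :
  (t, N) \in euclidean_pairs -> A <= B ->
  (forall m k : int, 0 <= (qnorm t N m k)%:~R * A + m%:~R * P + k%:~R * Q) ->
  forall x1 y1 x2 y2 : int, (x2 != 0) || (y2 != 0) ->
  B <= (qnorm t N x1 y1)%:~R * A + (qnorm t N x2 y2)%:~R * B
       + (x1 * x2 + t * x1 * y2 + N * y1 * y2)%:~R * P
       + (y1 * x2 - x1 * y2)%:~R * Q.
Proof.
move=> tN leAB reduced x1 y1 x2 y2 nz.
have disc := euclidean_pairs_disc tN.
have A_ge0 : 0 <= A.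
  have := reduced 1 0; have := reduced (-1) 0; rewrite /qnorm; lra.
have [z1 [z2 [inside le_z]]] :=
  exists_dual_vertex (x1 * x2 + t * x1 * y2 + N * y1 * y2) (y1 * x2 - x1 * y2)
    tN reduced.
have form_ge1 : 1 <= (dual_form t N z1 z2 x1 y1 x2 y2)%:~R :> R.
  by rewrite ler1z; apply: dual_form_ge1.
have norm_ge1 : 1 <= (qnorm t N x2 y2)%:~R :> R.
  by rewrite ler1z; apply: qnorm_ge1.
have gapB : 0 <= ((qnorm t N x2 y2)%:~R - 1) * (B - A).
  by rewrite mulr_ge0 ?subr_ge0.
have gapA : 0 <= ((dual_form t N z1 z2 x1 y1 x2 y2)%:~R - 1) * A.
  by rewrite mulr_ge0 ?subr_ge0.
rewrite /dual_form in gapA; move: gapA gapB le_z.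
move: (x1 * x2 + _ + _) (y1 * x2 - _) (qnorm t N x1 y1) (qnorm t N x2 y2).
move=> x y n1 n2; lra.
Qed.

(** * The five rings *)

Lemma Zadjoin_quadratic (C : numClosedFieldType) (w : C) (t N : int) :
  w ^+ 2 = t%:~R * w - N%:~R ->
  forall z, Zadjoin w z <-> exists x y : int, z = x%:~R + y%:~R * w.
Proof.
move=> wE z; split=> [[p ->] | [x [y ->]]].
  elim/poly_ind: p => [|p c [x [y IHp]]].
    by exists 0, 0; rewrite rmorph0 horner0 mul0r addr0.
  exists (c - y * N), (x + y * t).
  rewrite rmorphD rmorphM /= map_polyX map_polyC hornerMXaddC IHp.
  rewrite mulrDl -mulrA -expr2 wE; ring.
exists (x%:P + y%:P * 'X).
by rewrite rmorphD rmorphM /= map_polyX !map_polyC !hornerE.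
Qed.

(** If s^2 = d < 0 then s s^* = |d| = - s^2, and s can be cancelled. *)
Lemma conj_sqrtC_neg (C : numClosedFieldType) (d : C) :
  d < 0 -> (sqrtC d)^* = - sqrtC d.
Proof.
move=> d_lt0; have s_neq0 : sqrtC d != 0 by rewrite sqrtC_eq0 lt_eqF.
apply: (mulfI s_neq0).
by rewrite -normCK -normrX sqrtCK ltr0_norm // mulrN -expr2 sqrtCK.
Qed.

Lemma listed_ring_quadratic (C : numClosedFieldType) (O : C -> Prop) :
  listed_ring O ->
  exists (t N : int) (w : C),
  [/\ (t, N) \in euclidean_pairs, w + w^* = t%:~R, w * w^* = N%:~R &
      forall z, O z <-> exists x y : int, z = x%:~R + y%:~R * w].
Proof.
case=> -[D]; rewrite !inE => D_in ->; set s := sqrtC _;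
  have sE : s ^+ 2 = D%:~R by [apply: sqrtCK];
  have sC : s^* = - s by [rewrite conj_sqrtC_neg // ltrz0; lia].
  exists 0, (- D), s; split.
  - by case/orP: D_in => /eqP ->.
  - by rewrite sC subrr.
  - by rewrite sC mulrN -expr2 sE rmorphN.
  - apply: (@Zadjoin_quadratic _ _ 0 (- D)); rewrite sE; ring.
have half_neq0 : 2 != 0 :> C by rewrite pnatr_eq0.
have [N pairN DE] : exists2 N : int, (1, N) \in euclidean_pairs & D = 1 - 4 * N.
  by case/or3P: D_in => /eqP ->; [exists 1 | exists 2 | exists 3].
have wC : (2^-1 * (1 + s))^* = 2^-1 * (1 - s).
  by rewrite rmorphM rmorphD rmorph1 /= sC fmorphV rmorph_nat.
exists 1, N, (2^-1 * (1 + s)); rewrite wC; split.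
- exact: pairN.
- by field.
- have -> : 2^-1 * (1 + s) * (2^-1 * (1 - s)) = (1 - s ^+ 2) / 4 by field.
  by rewrite sE DE; field.
- apply: (@Zadjoin_quadratic _ _ 1 N).
  have -> : (2^-1 * (1 + s)) ^+ 2 = (1 + 2 * s + s ^+ 2) / 4 by field.
  by rewrite sE DE; field.
Qed.

Lemma mul_conj_quadratic (C : numClosedFieldType) (t N : int) (w : C) :
  w + w^* = t%:~R -> w * w^* = N%:~R -> forall x1 y1 x2 y2 : int,
  (x1%:~R + y1%:~R * w) * (x2%:~R + y2%:~R * w)^* =
  (x1 * x2 + t * x1 * y2 + N * y1 * y2)%:~R + (y1 * x2 - x1 * y2)%:~R * w.
Proof.
move=> w_tr w_nm x1 y1 x2 y2.
rewrite !(rmorphD, rmorphM, rmorphN) /= !rmorph_int -w_tr -w_nm; ring.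
Qed.

Lemma norm_quadratic (C : numClosedFieldType) (t N : int) (w : C) :
  w + w^* = t%:~R -> w * w^* = N%:~R -> forall x y : int,
  (x%:~R + y%:~R * w) * (x%:~R + y%:~R * w)^* = (qnorm t N x y)%:~R.
Proof.
move=> w_tr w_nm x y; rewrite (mul_conj_quadratic w_tr w_nm).
rewrite [y * x]mulrC subrr mul0r addr0.
by congr _%:~R; rewrite /qnorm; ring.
Qed.

Lemma listed_ring0 (C : numClosedFieldType) (O : C -> Prop) :
  listed_ring O -> O 0.
Proof.
move=> /listed_ring_quadratic[t [N [w [_ _ _ OE]]]].
by apply/OE; exists 0, 0; rewrite mul0r addr0.
Qed.

Lemma listed_ring1 (C : numClosedFieldType) (O : C -> Prop) :
  listed_ring O -> O 1.
Proof.
move=> /listed_ring_quadratic[t [N [w [_ _ _ OE]]]].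
by apply/OE; exists 1, 0; rewrite mul0r addr0.
Qed.

Lemma listed_ring_norm_ge1 (C : numClosedFieldType) (O : C -> Prop) (n : C) :
  listed_ring O -> O n -> n != 0 -> 1 <= `|n| ^+ 2.
Proof.
move=> /listed_ring_quadratic[t [N [w [tN w_tr w_nm OE]]]] /OE[x [y ->]] n_neq0.
rewrite normCK (norm_quadratic w_tr w_nm) ler1z.
apply: qnorm_ge1; first exact: euclidean_pairs_disc.
apply: contraNT n_neq0; rewrite negb_or !negbK => /andP[/eqP-> /eqP->].
by rewrite mul0r addr0.
Qed.

(** * Norms of lattice vectors *)

Lemma dotmx_lin2 (C : numClosedFieldType) (a b : 'rV[C]_2) (n1 n2 : C) :
  dotmx (n1 *: a + n2 *: b) (n1 *: a + n2 *: b) =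
  n1 * n1^* * dotmx a a + n2 * n2^* * dotmx b b
  + (n1 * n2^* * dotmx a b + (n1 * n2^* * dotmx a b)^*).
Proof.
rewrite dnormD !dnormZ !normCK.
by rewrite linearZl_LR linearZr_LR /= mulrA.
Qed.

Lemma hnorm_le (C : numClosedFieldType) (u v : 'cV[C]_2) :
  (hnorm u <= hnorm v) = (dotmx u^T u^T <= dotmx v^T v^T).
Proof. by rewrite ler_sqrtC // nnegrE dnorm_ge0. Qed.

Lemma dotmx_quadratic (C : numClosedFieldType) (t N : int) (w : C)
    (a b : 'rV[C]_2) :
  w + w^* = t%:~R -> w * w^* = N%:~R -> forall x1 y1 x2 y2 : int,
  let v := (x1%:~R + y1%:~R * w) *: a + (x2%:~R + y2%:~R * w) *: b in
  dotmx v v =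
  (qnorm t N x1 y1)%:~R * dotmx a a + (qnorm t N x2 y2)%:~R * dotmx b b
  + (x1 * x2 + t * x1 * y2 + N * y1 * y2)%:~R * (dotmx a b + (dotmx a b)^*)
  + (y1 * x2 - x1 * y2)%:~R * (w * dotmx a b + (w * dotmx a b)^*).
Proof.
move=> w_tr w_nm x1 y1 x2 y2 /=.
rewrite dotmx_lin2 !(norm_quadratic w_tr w_nm) (mul_conj_quadratic w_tr w_nm).
rewrite mulrDl !(rmorphD, rmorphM) /= !rmorph_int; ring.
Qed.

Lemma conj_trace_real (R : rcfType) (z : R[i]%C) :
  exists p : R, z + z^* = (p%:C)%C.
Proof. by apply/complex_realP; rewrite CrealE rmorphD /= conjCK addrC. Qed.

(** The squared norms and traces are real, so the coordinates reduce the claim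
    to [reduced_form_ge] over R; greediness for n = m + k w is the hypothesis
    of that lemma. *)
Lemma greedy_lattice_le (R : rcfType) (O : R[i]%C -> Prop)
    (a b : 'cV[R[i]%C]_2) (n1 n2 : R[i]%C) :
  listed_ring O -> greedy_reduced O a b -> O n1 -> O n2 -> n2 != 0 ->
  hnorm b <= hnorm (n1 *: a + n2 *: b).
Proof.
move=> /listed_ring_quadratic[t [N [w [tN w_tr w_nm OE]]]] [le_ab greedy].
move=> /OE[x1 [y1 ->]] /OE[x2 [y2 ->]] n2_neq0.
have [A AE] : exists A : R, dotmx a^T a^T = (A%:C)%C.
  by apply/complex_realP/ger0_real/dnorm_ge0.
have [B BE] : exists B : R, dotmx b^T b^T = (B%:C)%C.
  by apply/complex_realP/ger0_real/dnorm_ge0.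
have [P PE] := conj_trace_real (dotmx a^T b^T).
have [Q QE] := conj_trace_real (w * dotmx a^T b^T).
have normE (u1 v1 u2 v2 : int) :
    let v := (u1%:~R + v1%:~R * w) *: a + (u2%:~R + v2%:~R * w) *: b in
    dotmx v^T v^T = (((qnorm t N u1 v1)%:~R * A + (qnorm t N u2 v2)%:~R * B
      + (u1 * u2 + t * u1 * v2 + N * v1 * v2)%:~R * P
      + (v1 * u2 - u1 * v2)%:~R * Q)%:C)%C.
  rewrite /= !linearD !linearZ /= (dotmx_quadratic _ _ w_tr w_nm) AE BE PE QE.
  by rewrite !(rmorphD, rmorphM) /= !rmorph_int.
rewrite hnorm_le normE BE lecR; apply: reduced_form_ge => //.
- by move: le_ab; rewrite hnorm_le AE BE lecR.
- move=> m k; have : O (m%:~R + k%:~R * w) by apply/OE; exists m, k.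
  move=> /greedy; rewrite addrC hnorm_le.
  have := normE m k 1 0; rewrite /= mul0r addr0 scale1r => ->.
  rewrite BE lecR /qnorm; lra.
- apply: contraNT n2_neq0; rewrite negb_or !negbK => /andP[/eqP-> /eqP->].
  by rewrite mul0r addr0.
Qed.

Theorem proposition11 (R : realType) (O : R[i]%C -> Prop)
    (alpha beta : 'cV[R[i]%C]_2) (hO : listed_ring O)
    (hbasis : basis_of fullv [:: alpha; beta])
    (hdet : `|\det (row_mx alpha beta : 'M[R[i]%C]_2)| = 1)
    (hgreedy : greedy_reduced O alpha beta) :
  shortest_reduced O (lattice O alpha beta) alpha beta.
Proof.
have free_ab := basis_free hbasis.
have O0 := listed_ring0 hO; have O1 := listed_ring1 hO.
have a_neq0 : alpha != 0 by apply: free_not0 free_ab _; apply: mem_head.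
split; [by split | split | split].
- by exists 1, 0; rewrite scale1r scale0r addr0.
- exact: a_neq0.
- move=> _ [n1 [n2 [On1 On2 ->]]].
  have [-> | n2_neq0 _] := eqVneq n2 0; last first.
    exact: le_trans hgreedy.1 (greedy_lattice_le hO hgreedy On1 On2 n2_neq0).
  rewrite scale0r addr0 scaler_eq0 negb_or => /andP[n1_neq0 _].
  rewrite hnorm_le linearZ /= dnormZ ler_peMl ?dnorm_ge0 //.
  exact: listed_ring_norm_ge1 hO On1 n1_neq0.
- by exists 0, 1; rewrite scale1r scale0r add0r.
- exact: free_ab.
- move=> _ [n1 [n2 [On1 On2 ->]]] free_av.
  apply: (greedy_lattice_le hO hgreedy On1 On2); apply/eqP => n2_0.
  move: free_av; rewrite n2_0 scale0r addr0.
  rewrite (perm_free (permEl (perm_catC [:: alpha] [:: _]))) free_cons.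
  rewrite span_seq1.
  by rewrite memvZ ?memv_line.
Qed.
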